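(* Let $\bm{Y}^{(n)}=(Y_1,\dots,Y_n)$ follow the multivariate phase-type distribution with parameters $\bm{\alpha}, A_1,\dots,A_n, D_1,\dots,D_n$ (as defined in the context). Let $\bm{\gamma}_1=\bm{\alpha}$ and, for $k\ge 2$, $$\bm{\gamma}_k=\bm{\alpha}(-A_1)^{-1}D_1(-A_2)^{-1}D_2\cdots(-A_{k-1})^{-1}D_{k-1}.$$ Then for $1\le k<\ell\le n$, $$\mathrm{Cov}(Y_k,Y_\ell)=\bm{\gamma}_k(-A_k)^{-2}D_k(-A_{k+1})^{-1}D_{k+1}\cdots(-A_{\ell-1})^{-1}D_{\ell-1}(-A_\ell)^{-1}\bm{1}-\big(\bm{\gamma}_k(-A_k)^{-1}\bm{1}\big)\big(\bm{\gamma}_\ell(-A_\ell)^{-1}\bm{1}\big).$$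
   Context: $\bm{1}$ and $\bm{0}$ denote vectors of ones and zeros of appropriate size and orientation. Multivariate phase-type distribution: let $n\in\{1,2,\dots\}$ and let $\{\varphi(t)\mid t\ge 0\}$ be a time-homogeneous Markov jump process on the finite state space $\{\star\}\cup\mathcal{S}_1\cup\cdots\cup\mathcal{S}_n$ (disjoint union), where $\star$ is absorbing and every $\mathcal{S}_k$ is a finite nonempty set of transient states. Its generator has the following form. For $k=1,\dots,n$, the transition rates within $\mathcal{S}_k$ are given by a square matrix $A_k$ indexed by $\mathcal{S}_k$ (off-diagonal entries nonnegative). For $k<n$, the transition rates from $\mathcal{S}_k$ to $\mathcal{S}_{k+1}$ are given by a nonnegative $|\mathcal{S}_k|\times|\mathcal{S}_{k+1}|$ matrix $D_k$. The transition rates from $\mathcal{S}_n$ to $\star$ are given by the vector $D_n\bm{1}$, with $D_n$ a nonnegative matrix with rows indexed by $\mathcal{S}_n$. All other transition rates between distinct states are $0$; hence $A_k\bm{1}+D_k\bm{1}=\bm{0}$ for all $k$, and each $A_k$ is invertible by transience. The process starts in $\mathcal{S}_1$ with initial distribution given by the probability (row) vector $\bm{\alpha}$ on $\mathcal{S}_1$. The vector $(Y_1,\dots,Y_n)$ follows the multivariate phase-type distribution with these parameters if it is (distributed as) the vector of times spent in the subsets $\mathcal{S}_k$: $Y_k=\int_0^\infty \mathbf{1}_{\{\varphi(s)\in\mathcal{S}_k\}}\,ds$, $k=1,\dots,n$. *)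

(* Defs.v *)
From HB Require Import structures.
From mathcomp Require Import all_boot all_order all_algebra.
From mathcomp Require Import all_classical all_reals all_analysis.
From mathcomp Require Import measurable_realfun.

Set Implicit Arguments.
Unset Strict Implicit.
Unset Printing Implicit Defensive.

Import Order.TTheory GRing.Theory Num.Theory.
Import numFieldNormedType.Exports.

Local Open Scope classical_set_scope.
Local Open Scope ring_scope.

Section MarkovJumpProcess.
Context {R : realType} {E : finType}.
Implicit Types (p : R -> E -> E -> R) (q : E -> E -> R).

(* [p t x y] is the probability of moving from [x] to [y] in time [t]; only
   the values at [0 <= t] are meaningful. *)
Record transition_function p : Prop := {
  transition_ge0 : forall t x y, 0 <= t -> 0 <= p t x y;
  transition_sum1 : forall t x, 0 <= t -> \sum_y p t x y = 1;
  transition_0 : forall x y, p 0 x y = (x == y)%:R;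
  Chapman_Kolmogorov : forall s t x y, 0 <= s -> 0 <= t ->
    p (s + t) x y = \sum_z p s x z * p t z y }.

Definition generator p q : Prop :=
  forall x y, (p t x y - p 0 x y) / t @[t --> 0^'+] --> q x y.

(* The potential kernel at (x, x), i.e. the expected total time spent in [x]
   by the chain started at [x], is finite. *)
Definition transient p (x : E) : Prop :=
  (\int[lebesgue_measure]_(t in `[0%R, +oo[) (p t x x)%:E < +oo)%E.

(* [phi] is indexed by [R] but only its values at [0 <= t] are meaningful.
   The Markov property is stated for an arbitrary finite history [h] of
   (time, state) pairs before time [s], with the conditional probability
   multiplied out so that null conditioning events need no convention. *)
Record Markov_jump_process d (T : measurableType d) (P : probability T R)
    (phi : R -> T -> E) p : Prop := {
  mjp_measurable : forall t x, 0 <= t -> measurable [set w | phi t w = x];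
  mjp_right_continuous : forall w t, 0 <= t ->
    \forall s \near t^'+, phi s w = phi t w;
  mjp_left_limit : forall w t, 0 < t ->
    exists x, \forall s \near t^'-, phi s w = x;
  mjp_Markov : forall (s t : R) (x y : E) (h : seq (R * E)),
    0 <= s -> 0 <= t -> (forall u, u \in h -> 0 <= u.1 <= s) ->
    let past := [set w | forall u, u \in h -> phi u.1 w = u.2] in
    P ([set w | phi (s + t) w = y] `&` ([set w | phi s w = x] `&` past)) =
    ((p t x y)%:E * P ([set w | phi s w = x] `&` past))%E }.

End MarkovJumpProcess.

(* The sets of transient states are numbered from 0 to n - 1, and the k-th one
   is ['I_(d k)].  The families [d], [A], [D] are indexed by all of [nat], but
   only the indices [k < n] matter (plus [d n], the number of columns of the
   last exit matrix [D n.-1], which is arbitrary). *)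
Definition state (n : nat) (d : nat -> nat) : finType :=
  option {k : 'I_n & 'I_(d k)}.

Definition phase n d (x : state n d) : option 'I_n := omap (@tag _ _) x.

Section MultivariatePhaseType.
Context {R : realType} {d : nat -> nat}.
Variables (alpha : 'rV[R]_(d 0)) (A : forall k, 'M[R]_(d k))
  (D : forall k, 'M[R]_(d k, d k.+1)).

Record mph_parameters (n : nat) : Prop := {
  mph_length : (0 < n)%N;
  mph_size : forall k, (k < n)%N -> (0 < d k)%N;
  mph_alpha_ge0 : forall i, 0 <= alpha 0 i;
  mph_alpha_sum1 : \sum_i alpha 0 i = 1;
  mph_A_ge0 : forall k (i j : 'I_(d k)), (k < n)%N -> i != j -> 0 <= A k i j;
  mph_D_ge0 : forall k i j, (k < n)%N -> 0 <= D k i j;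
  mph_row_sum0 : forall k, (k < n)%N ->
    A k *m const_mx 1 + D k *m const_mx 1 = 0 :> 'cV_(d k) }.

(* [None] is the absorbing state; the [cast_ord]s only transport a column index
   along the equality of the phase numbers. *)
Definition mph_rate n (x y : state n d) : R :=
  match x, y with
  | None, _ => 0
  | Some (existT k i), None =>
      if k.+1 == n then (D k *m const_mx 1 : 'cV_(d k)) i 0 else 0
  | Some (existT k i), Some (existT l j) =>
      match (l : nat) =P (k : nat), (l : nat) =P k.+1 with
      | ReflectT e, _ => A k i (cast_ord (congr1 d e) j)
      | _, ReflectT e => D k i (cast_ord (congr1 d e) j)
      | _, _ => 0
      end
  end.

Definition mph_initial n (x : state n d) : R :=
  match x with
  | Some (existT k i) =>
      match (k : nat) =P 0%N with
      | ReflectT e => alpha 0 (cast_ord (congr1 d e) i)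
      | ReflectF _ => 0
      end
  | None => 0
  end.

Definition occupation_time n T (phi : R -> T -> state n d) (k : 'I_n)
    (w : T) : \bar R :=
  (\int[lebesgue_measure]_(s in `[0%R, +oo[)
     ((phase (phi s w) == Some k)%:R)%:E)%E.

(* The process may live on another probability space than [Y]: the two vectors
   are only required to have the same law, as random vectors in [\bar R]^n
   since occupation times are a priori extended real numbers. *)
Definition mph_distributed n dT (T : measurableType dT)
    (P : probability T R) (Y : 'I_n -> {RV P >-> R}) : Prop :=
  mph_parameters n /\
  exists (dU : measure_display) (U : measurableType dU)
    (Q : probability U R) (phi : R -> U -> state n d)
    (p : R -> state n d -> state n d -> R),
    [/\ transition_function p, generator p (@mph_rate n),
        forall x, x != None -> transient p x,
        Markov_jump_process Q phi p &
        (forall x, Q [set w | phi 0 w = x] = (mph_initial x)%:E) /\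
        forall B : set (n.-tuple (\bar R)), measurable B ->
          P [set w | B [tuple (Y k w)%:E | k < n]] =
          Q [set w | B [tuple occupation_time phi k w | k < n]]].

(* (-A_k)^-1 D_k (-A_(k+1))^-1 D_(k+1) ... (-A_(l-1))^-1 D_(l-1); this is the
   identity for k = l, and a junk 0 for k > l. *)
Fixpoint passage (k l : nat) : 'M[R]_(d k, d l) :=
  match k =P l with
  | ReflectT e => castmx (erefl (d k), congr1 d e) 1%:M
  | ReflectF _ =>
      match l with
      | 0%N => 0
      | l'.+1 => passage k l' *m invmx (- A l') *m D l'
      end
  end.

Definition entrance (k : nat) : 'rV[R]_(d k) := alpha *m passage 0 k.

End MultivariatePhaseType.

(* Main.v *)
Require Import Defs.
From HB Require Import structures.
From mathcomp Require Import all_boot all_order all_algebra.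
From mathcomp Require Import all_classical all_reals all_analysis.
From mathcomp Require Import measurable_realfun.
From mathcomp Require Import ring lra.
Import Order.TTheory GRing.Theory Num.Theory.
Import numFieldNormedType.Exports.
Local Open Scope classical_set_scope.
Local Open Scope ring_scope.

(** The proof expresses both moments through the potential kernel
    G(x, y) = \int_0^oo p_t(x, y) dt of the Markov chain, and then inverts the
    block matrix of rates.

    Probabilistic part. Right-continuity of the paths makes
    (t, w) |-> phi_t(w) jointly measurable, so Tonelli's theorem turns the mean
    of the time spent in a state x into \int_0^oo Q(phi_t = x) dt, which is the
    initial law multiplied by G ([expected_occupation]).  For two states x, y
    such that x is unreachable from y, the mean of the product of their
    occupation times is the integral of Q(phi_s = x, phi_t = y) over all
    s and t; only s <= t contributes, and there the Markov property splits the
    integrand into Q(phi_s = x) p_(t - s)(x, y).  Hence the product moment is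
    the mean occupation time of x multiplied by G(x, y)
    ([expected_occupation_product]).

    Analytic part. Transience only bounds the diagonal of G.  The whole column
    of a transient state y is finite because starting at y maximizes the
    expected time spent in y; this is shown for a time grid by induction on the
    number of steps, up to an error that vanishes with the mesh
    ([potential_le]).  Shifting the time integral by h gives
    G p_h = G - \int_0^h p_t dt entrywise, and dividing by h before letting h
    tend to 0 yields G q = - 1 on the columns of transient states, where q is
    the generator ([potential_generator]).

    Algebraic part. The rate matrix is block bidiagonal, with blocks A_k on the
    diagonal and D_k above it.  Solving G q = - 1 for the blocks of G, column
    by column, shows that each - A_l is invertible and that the (k, l) block
    of G is (- A_k)^-1 D_k ... D_(l-1) (- A_l)^-1, being 0 for k > l
    ([block_passage]).  In particular earlier phases are unreachable from later
    ones, and the two moments above become the matrix products of the theorem.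
    The moments of Y are those of the occupation times since they depend on the
    joint law only ([same_law_covariance]). *)

(** * Translation invariance of the Lebesgue measure *)

Section Shift.
Context {R : realType} (h : R).

Let shift : R -> measurableTypeR R := fun t => h + t.

Let measurable_shift : measurable_fun [set: R] shift.
Proof. exact: measurable_funD. Qed.

HB.instance Definition _ := isMeasurableFun.Build _ _ _ _ shift measurable_shift.

Lemma lebesgue_measure_shift (A : set R) : measurable A ->
  pushforward lebesgue_measure (fun t => h + t : measurableTypeR R) A
  = lebesgue_measure A.
Proof.
move=> mA; rewrite -[fun t => _]/shift.
apply/esym.
apply: (@lebesgue_measure_unique _ (pushforward lebesgue_measure shift)) => //=.
move=> _ [[a b]] _ <-.
rewrite /pushforward.
rewrite (_ : _ @^-1` _ = `]a - h, b - h]%classic); last first.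
  by apply/seteqP; split=> x /=; rewrite !in_itv /= ltrBlDl lerBrDl.
rewrite !lebesgue_measure_itv/= !lte_fin ltrD2r.
by case: ifP => // _; rewrite -!EFinD opprD addrACA subrr addr0.
Qed.

Lemma ge0_integral_shift (D : set R) (f : R -> \bar R) :
  measurable D -> measurable_fun D f -> (forall t, D t -> 0 <= f t)%E ->
  (\int[lebesgue_measure]_(t in D) f t =
   \int[lebesgue_measure]_(t in [set t | D (h + t)%R]) f (h + t)%R)%E.
Proof.
move=> mD mf f0.
transitivity (\int[pushforward lebesgue_measure shift]_(t in D) f t)%E.
  by apply: eq_measure_integral => //= A mA AS; exact/esym/lebesgue_measure_shift.
by rewrite ge0_integral_pushforward// => t /set_mem; exact: f0.
Qed.

End Shift.

(** * Potential kernel of a finite transition function *)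

Section TransitionFunction.
Context {R : realType} {E : finType} {p : R -> E -> E -> R}.
Hypothesis p_tf : transition_function p.

Let mu := @lebesgue_measure R.

(** The expected time spent in [y] during the set of times [A], for the chain
    started at [x]. *)
Definition sojourn (A : set R) (x y : E) : \bar R :=
  \int[mu]_(t in A) (p t x y)%:E.

Definition potential (x y : E) : \bar R := sojourn `[0%R, +oo[ x y.

Lemma standard_of_generator (q : E -> E -> R) : generator p q ->
  forall x y, p t x y @[t --> 0^'+] --> ((x == y)%:R : R).
Proof.
move=> gen x y.
have : (p t x y - p 0 x y) / t * t + p 0 x y @[t --> 0^'+] --> q x y * 0 + p 0 x y.
  apply: cvgD; last exact: cvg_cst.
  apply: cvgM; first exact: gen.
  exact: cvg_at_right_filter.
rewrite mulr0 add0r (transition_0 p_tf).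
apply: cvg_trans; apply: near_eq_cvg.
near=> t.
have t0 : t != 0 by apply: lt0r_neq0; near: t; exact: nbhs_right_gt.
by rewrite divfK// subrK.
Unshelve. all: by end_near. Qed.

Hypothesis p_std : forall x y, p t x y @[t --> 0^'+] --> ((x == y)%:R : R).

(** Since the state space is finite, continuity at 0 is uniform in the states. *)
Lemma transition_near0 (e : R) : 0 < e -> exists2 c, 0 < c &
  forall h x y, 0 <= h -> h < c -> `|p h x y - (x == y)%:R| < e.
Proof.
move=> e0.
have : \forall h \near 0^'+, forall x y, `|(x == y)%:R - p h x y| < e.
  apply: filter_forall => x; apply: filter_forall => y.
  by move/cvgrPdist_lt: (p_std x y); exact.
move=> [c /= c0 Hc]; exists c => // h x y.
rewrite le_eqVlt => /predU1P[<- _|h0 hc].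
  by rewrite (transition_0 p_tf) subrr normr0.
by rewrite distrC; apply: Hc => //=; rewrite sub0r normrN gtr0_norm.
Qed.

(** By Chapman-Kolmogorov p_t - p_s = p_s (p_(t-s) - 1), and p_s has row sums 1,
    so the modulus of continuity at 0 is one everywhere. *)
Lemma transition_equicontinuous (e : R) : 0 < e -> exists2 c, 0 < c &
  forall s t x y, 0 <= s -> 0 <= t -> `|t - s| < c -> `|p t x y - p s x y| < e.
Proof.
move=> e0; have [c c0 Hc] := transition_near0 _ (divr_gt0 e0 (ltr0n _ 2)).
exists c => // s t x y; wlog le_st : s t / s <= t => [hw s0 t0 stc|].
  have [le_st|/ltW ts] := leP s t; first exact: hw.
  by rewrite distrC; apply: hw => //; rewrite distrC.
move=> s0 t0; rewrite ger0_norm ?subr_ge0// => tsc.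
have h0 : 0 <= t - s by rewrite subr_ge0.
rewrite -{1}(subrKC s t) (Chapman_Kolmogorov p_tf)//.
have -> : p s x y = \sum_z p s x z * (z == y)%:R.
  rewrite (bigD1 y)//= eqxx mulr1 big1 ?addr0// => z /negbTE ->.
  by rewrite mulr0.
rewrite -sumrB; apply: le_lt_trans (ler_norm_sum _ _ _) _.
apply: (@le_lt_trans _ _ (\sum_z p s x z * (e / 2))).
  apply: ler_sum => z _; rewrite -mulrBr normrM ger0_norm ?(transition_ge0 p_tf)//.
  by rewrite ler_wpM2l ?(transition_ge0 p_tf)//; apply/ltW/Hc.
by rewrite -mulr_suml (transition_sum1 p_tf)// mul1r; lra.
Qed.

Lemma measurable_transition (D : set R) x y : measurable D ->
  (forall t, D t -> 0 <= t) -> measurable_fun D (fun t => (p t x y)%:E).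
Proof.
move=> mD D0; apply/measurable_EFinP.
(* [p] is unconstrained at negative times, so continuity on the whole line
   needs the argument to be clamped at 0. *)
pose f (t : R) := p (Num.max 0 t) x y.
apply: (@eq_measurable_fun _ _ _ _ D f).
  by move=> t /set_mem /D0 t0; rewrite /f max_r.
apply: measurable_funTS; apply: continuous_measurable_fun => t.
apply/cvgrPdist_lt => e e0.
have [c c0 Hc] := transition_equicontinuous _ e0.
near=> s; apply: Hc; rewrite ?le_max ?lexx//.
have : `|t - s| < c by near: s; exact: cvgr_dist_lt.
apply: le_lt_trans.
have := ler_norm (t - s).
have := ler_norm (s - t); rewrite distrC.
by rewrite /Num.max; case: ltP => t0; case: ltP => s0; rewrite ler_norml; lra.
Unshelve. all: by end_near. Qed.

Lemma transition_ge0_ereal t x y : 0 <= t -> (0 <= (p t x y)%:E)%E.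
Proof. by move=> t0; rewrite lee_fin (transition_ge0 p_tf). Qed.

Lemma sojourn_ge0 (A : set R) x y : (forall t, A t -> 0 <= t) ->
  (0 <= sojourn A x y)%E.
Proof. by move=> A0; apply: integral_ge0 => t /A0; exact: transition_ge0_ereal. Qed.

(** Chapman-Kolmogorov integrated over the second time: the chain makes a step of
    length [h] and then restarts. *)
Lemma sojournDl (h : R) (A : set R) x y : 0 <= h -> measurable A ->
    (forall t, A t -> 0 <= t) ->
  (\int[mu]_(t in A) (p (h + t)%R x y)%:E
   = \sum_z (p h x z)%:E * sojourn A z y)%E.
Proof.
move=> h0 mA A0.
under eq_integral => t /set_mem /A0 t0.
  rewrite (Chapman_Kolmogorov p_tf)// -sumEFin.
  under eq_bigr do rewrite EFinM.
  over.
have mp z : measurable_fun A (fun t => (p t z y)%:E) by exact: measurable_transition.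
rewrite ge0_integral_sum//.
- apply: eq_bigr => z _; rewrite ge0_integralZl//.
  + exact: mp.
  + by move=> t /A0; exact: transition_ge0_ereal.
  + exact: transition_ge0_ereal.
- by move=> z; apply: measurable_funeM; exact: mp.
- by move=> z t /A0 t0; rewrite mule_ge0 ?transition_ge0_ereal.
Qed.

(** The same identity with the step of length [h] made at the end. *)
Lemma sojournDr (h : R) (A : set R) x y : 0 <= h -> measurable A ->
    (forall t, A t -> 0 <= t) ->
  (\int[mu]_(t in A) (p (h + t)%R x y)%:E
   = \sum_z sojourn A x z * (p h z y)%:E)%E.
Proof.
move=> h0 mA A0.
under eq_integral => t /set_mem /A0 t0.
  rewrite addrC (Chapman_Kolmogorov p_tf)// -sumEFin.
  under eq_bigr do rewrite EFinM muleC.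
  over.
have mp z : measurable_fun A (fun t => (p t x z)%:E) by exact: measurable_transition.
rewrite ge0_integral_sum//.
- apply: eq_bigr => z _; rewrite ge0_integralZl//; first exact: muleC.
  + exact: mp.
  + by move=> t /A0; exact: transition_ge0_ereal.
  + exact: transition_ge0_ereal.
- by move=> z; apply: measurable_funeM; exact: mp.
- by move=> z t /A0 t0; rewrite mule_ge0 ?transition_ge0_ereal.
Qed.

(** The times after [h] are translated back to 0, to which Chapman-Kolmogorov can
    then be applied. *)
Lemma sojourn_split (h : R) (b : itv_bound R) x y :
    0 <= h -> (BLeft h <= b)%O ->
  (sojourn [set` Interval (BLeft 0%R) b] x y = sojourn `[0%R, h[ x y +
    \int[mu]_(t in [set t | [set` Interval (BLeft h) b] (h + t)%R])
      (p (h + t)%R x y)%:E)%E.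
Proof.
move=> h0 hb.
have ge0 (c : R) (d : itv_bound R) t : 0 <= c -> [set` Interval (BLeft c) d] t -> 0 <= t.
  by move=> c0 /=; rewrite itv_boundlr => /andP[+ _]; rewrite bnd_simp; exact: le_trans.
rewrite -(ge0_integral_shift h _ (fun t => (p t x y)%:E))//; last 2 first.
- by apply: measurable_transition => // t; exact: ge0.
- by move=> t /(ge0 _ _ _ h0); exact: transition_ge0_ereal.
rewrite /sojourn -ge0_integral_setU//.
- by rewrite -itv_bndbnd_setU.
- apply: measurable_transition; first exact: measurableU.
  by move=> t [/ge0|/ge0]; exact.
- by move=> t [/ge0|/ge0] H; apply: transition_ge0_ereal; exact: H.
- apply/disj_setPS => t [/=]; rewrite !itv_boundlr => /andP[_ +] /andP[+ _].
  by rewrite !bnd_simp => /lt_geF ->.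
Qed.

Lemma sojourn_addl (h T : R) x y : 0 <= h -> 0 <= T ->
  (sojourn `[0%R, (h + T)%R[ x y = sojourn `[0%R, h[ x y +
    \sum_z (p h x z)%:E * sojourn `[0%R, T[ z y)%E.
Proof.
move=> h0 T0; rewrite (sojourn_split h)//; last by rewrite bnd_simp lerDl.
rewrite [X in integral _ X](_ : _ = `[0, T[%classic).
  by rewrite sojournDl// => t /=; rewrite in_itv => /andP[].
by apply/seteqP; split => t /=; rewrite !in_itv/= lerDl ltrD2l.
Qed.

Lemma potential_addr (h : R) x y : 0 <= h ->
  (potential x y = sojourn `[0%R, h[ x y +
    \sum_z potential x z * (p h z y)%:E)%E.
Proof.
move=> h0; rewrite {1}/potential (sojourn_split h (BInfty _ false))//.
rewrite [X in integral _ X](_ : _ = `[0, +oo[%classic).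
  by rewrite sojournDr// => t /=; rewrite in_itv => /andP[].
by apply/seteqP; split => t /=; rewrite !in_itv/= lerDl.
Qed.

Lemma sojourn_near0 (e : R) : 0 < e -> exists2 c, 0 < c &
  forall h x y, 0 <= h -> h < c ->
    ((h * ((x == y)%:R - e))%:E <= sojourn `[0%R, h[ x y
      <= (h * ((x == y)%:R + e))%:E)%E.
Proof.
move=> e0; have [c c0 Hc] := transition_near0 _ e0.
exists c => // h x y h0 hc.
have cstE (a : R) : (\int[mu]_(t in `[0%R, h[) cst a%:E t = (h * a)%:E)%E.
  rewrite integral_cst//= lebesgue_measure_itv/= lte_fin.
  case: ltP => [_|h0']; first by rewrite -EFinD subr0 -EFinM mulrC.
  have -> : h = 0 by apply: le_anti; rewrite h0 h0'.
  by rewrite mul0r mule0.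
have mp : measurable_fun `[0%R, h[%classic (fun t => (p t x y)%:E).
  by apply: measurable_transition => // t /=; rewrite in_itv => /andP[].
have pe t : `[0%R, h[%classic t -> 0 <= t /\ `|p t x y - (x == y)%:R| < e.
  by rewrite /= in_itv => /andP[t0 th]; split=> //; exact/Hc/(lt_trans th).
apply/andP; split.
  apply: (@le_trans _ _ (h * Num.max 0 ((x == y)%:R - e))%:E).
    by rewrite lee_fin ler_wpM2l// le_max lexx orbT.
  rewrite -cstE; apply: ge0_le_integral => //.
  - by move=> t _; rewrite lee_fin le_max lexx.
  - move=> t /pe[t0]; rewrite lee_fin ge_max (transition_ge0 p_tf)//= ltr_norml.
    by move=> /andP[? _]; lra.
rewrite -cstE; apply: ge0_le_integral => //.
- by move=> t /pe[t0 _]; exact: transition_ge0_ereal.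
- by move=> t /pe[t0]; rewrite lee_fin ltr_norml => /andP[_ ?]; lra.
Qed.

Lemma sojourn_short (e : R) : 0 < e -> exists2 c, 0 < c &
  forall h x y, 0 <= h -> h < c -> x != y ->
    (sojourn `[0%R, h[ x y <= (h * e)%:E)%E.
Proof.
move=> e0; have [c c0 Hc] := sojourn_near0 _ e0.
exists c => // h x y h0 hc /negbTE xy.
by have := Hc h x y h0 hc; rewrite xy !add0r => /andP[].
Qed.

(** Starting at [y] maximizes the expected time spent in [y], up to the error [e]
    per unit of time: a chain started elsewhere spends at most [h * e] there in
    the first step, and then is averaged over starting points that are already
    controlled on a horizon shorter by one step. *)
Lemma sojourn_iter_le (h e : R) y : 0 <= h -> 0 <= e ->
    (forall x, x != y -> (sojourn `[0%R, h[ x y <= (h * e)%:E)%E) ->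
  forall N x, (sojourn `[0%R, (N%:R * h)%R[ x y
     <= sojourn `[0%R, (N%:R * h)%R[ y y + (N%:R * h * e)%:E)%E.
Proof.
move=> h0 e0 He; elim=> [|N IH] x.
  by rewrite !mul0r /sojourn set_itvco0 !integral_set0 add0e.
have Nh0 : 0 <= N%:R * h by rewrite mulr_ge0.
have ge0 b z : (0 <= sojourn `[0%R, b[ z y)%E.
  by apply: sojourn_ge0 => t /=; rewrite in_itv => /andP[].
have [->|xy] := eqVneq x y.
  by rewrite leeDl// lee_fin !mulr_ge0.
have NhS : N.+1%:R * h = h + N%:R * h by rewrite -natr1 mulrDl mul1r addrC.
rewrite NhS sojourn_addl// mulrDl EFinD addeCA.
apply: leeD; first exact: He.
set M := (X in (_ <= X)%E).
have M0 : (0 <= M)%E by rewrite adde_ge0// lee_fin mulr_ge0.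
have {1}-> : (M = \sum_z (p h x z)%:E * M)%E.
  rewrite -ge0_sume_distrl; last by move=> z _; exact: transition_ge0_ereal.
  by rewrite sumEFin (transition_sum1 p_tf)// mul1e.
apply: lee_sum => z _; apply: lee_wpmul2l; first exact: transition_ge0_ereal.
apply: (le_trans (IH z)); apply: leeD => //.
apply: ge0_subset_integral => //=.
- by apply: measurable_transition => // t /=; rewrite in_itv => /andP[].
- by move=> t; rewrite in_itv => /andP[t0 _]; exact: transition_ge0_ereal.
- by apply: subset_itvl; rewrite bnd_simp lerDr.
Qed.

(** The rate [1 / T] of the error makes it at most 1 over a horizon [T], so
    the bound survives the limit of large [T]. *)
Lemma sojourn_le T x y : 0 <= T ->
  (sojourn `[0%R, T[ x y <= sojourn `[0%R, T[ y y + 1)%E.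
Proof.
rewrite le_eqVlt => /predU1P[<-|T0].
  by rewrite /sojourn set_itvco0 !integral_set0 add0e lee_fin.
have e0 : 0 < T^-1 by rewrite invr_gt0.
have [c c0 Hc] := sojourn_short _ e0.
(* enough steps for the mesh [T / N] to be below [c] *)
pose N := (Num.bound (T / c)).+1.
have N0 : (0 : R) < N%:R by rewrite ltr0n.
have TNc : T / N%:R < c.
  rewrite ltr_pdivrMr// mulrC -ltr_pdivrMr//.
  have Tc : 0 <= T / c by rewrite divr_ge0 // ltW.
  by apply: lt_le_trans (archi_boundP Tc) _; rewrite ler_nat.
have TN : N%:R * (T / N%:R) = T by rewrite mulrC divfK// gt_eqF.
have TN0 : 0 <= T / N%:R by rewrite divr_ge0// ltW.
have := sojourn_iter_le _ _ _ TN0 (ltW e0) (fun x => Hc _ x y TN0 TNc) N x.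
by rewrite TN divff// gt_eqF.
Qed.

(** Finiteness of the diagonal of the potential, which is what transience says,
    therefore propagates to the whole column. *)
Lemma potential_le x y : (potential x y <= potential y y + 1)%E.
Proof.
have cup : `[0%R, +oo[%classic = \bigcup_i `[0%R, i%:R[%classic :> set R.
  apply/seteqP; split => t /=; rewrite in_itv/=.
    rewrite andbT => t0; exists (Num.bound t) => //=.
    by rewrite in_itv/= t0 archi_boundP.
  by move=> [i _] /=; rewrite in_itv/= => /andP[->].
have ge0 (i : nat) t : `[0%R, i%:R[%classic t -> (0 : R) <= t.
  by rewrite /= in_itv => /andP[].
rewrite {1}/potential /sojourn cup.
have cvgi : (sojourn `[0%R, i%:R[%classic x y @[i --> \oo] -->
    \int[mu]_(t in \bigcup_i `[0%R, i%:R[%classic) (p t x y)%:E)%E.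
  apply: ge0_nondecreasing_set_cvg_integral => //.
  - apply/nondecreasing_seqP => i; rewrite subsetEset.
    by apply: subset_itvl; rewrite bnd_simp ler_nat.
  - by move=> i; apply: measurable_transition => //; exact: ge0.
  - by move=> i t /ge0; exact: transition_ge0_ereal.
rewrite -(cvg_lim _ cvgi)//; apply: lime_le; first exact: cvgP cvgi.
apply: nearW => i; apply: le_trans (sojourn_le i%:R x y _) _ => //.
apply: leeD => //; apply: ge0_subset_integral => //=.
- by apply: measurable_transition => // t /=; rewrite in_itv => /andP[].
- by move=> t; rewrite in_itv => /andP[t0 _]; exact: transition_ge0_ereal.
- by apply: subset_itvl; rewrite bnd_simp.
Qed.

(** By continuity of [p] at 0, a chain started at [x] has hardly left [x] before
    a short time [h]. *)
Lemma sojourn_rate x y :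
  fine (sojourn `[0%R, h[ x y) / h @[h --> 0^'+] --> ((x == y)%:R : R).
Proof.
apply/cvgrPdist_le => e e0; have [c c0 Hc] := sojourn_near0 _ e0.
near=> h.
have h0 : 0 < h by near: h; exact: nbhs_right_gt.
have hc : h < c by near: h; exact: nbhs_right_lt.
have /andP[lo up] := Hc h x y (ltW h0) hc.
have fS : sojourn `[0, h[ x y \is a fin_num.
  by rewrite fin_real//; apply/andP; split;
    [apply: lt_le_trans lo|apply: le_lt_trans up _]; rewrite ?ltNyr ?ltry.
move: lo up; rewrite -(fineK fS) !lee_fin => lo up.
rewrite distrC ler_norml; apply/andP; split.
  by rewrite lerBrDr ler_pdivlMr// mulrC addrC.
by rewrite lerBlDr ler_pdivrMr// mulrC addrC.
Unshelve. all: by end_near. Qed.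

(** On the column of a transient state the potential is a left inverse of minus
    the generator: divide G p_h = G - \int_0^h p_t dt by [h] and let [h] tend
    to 0.  Infinite entries [potential x z], as for an absorbing [z], are replaced
    by 0 by [fine]; this is harmless since finiteness of [potential x y] forces
    [p h z y = 0] for such [z]. *)
Lemma potential_generator (q : E -> E -> R) x y :
    generator p q -> (potential x y < +oo)%E ->
  \sum_z fine (potential x z) * q z y = - (x == y)%:R.
Proof.
move=> gen fG.
have G0 z : (0 <= potential x z)%E.
  by apply: sojourn_ge0 => t /=; rewrite in_itv => /andP[].
have addr h : 0 <= h -> \sum_z fine (potential x z) * p h z y
    = fine (potential x y) - fine (sojourn `[0%R, h[ x y).
  move=> h0; have eG := potential_addr h x y h0.
  have S0 : (0 <= sojourn `[0%R, h[ x y)%E.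
    by apply: sojourn_ge0 => t /=; rewrite in_itv => /andP[].
  have t0 z : (0 <= potential x z * (p h z y)%:E)%E.
    by rewrite mule_ge0// transition_ge0_ereal.
  have fS : sojourn `[0%R, h[ x y \is a fin_num.
    rewrite ge0_fin_numE//; apply: le_lt_trans fG.
    by rewrite eG leeDl// sume_ge0.
  have ft z : (potential x z * (p h z y)%:E)%E \is a fin_num.
    rewrite ge0_fin_numE//; apply: le_lt_trans fG.
    by rewrite eG (bigD1 z)//= addeCA leeDl// adde_ge0// sume_ge0.
  rewrite {}eG fineD//; last by apply/sum_fin_numP.
  rewrite addrC addKr -sum_fine//; apply: eq_bigr => z _.
  move: (ft z) (G0 z); case: (potential x z) => //=.
  have := transition_ge0 p_tf z y h0; rewrite le_eqVlt => /predU1P[<-|pzy].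
    by rewrite mule0 mul0r.
  by rewrite gt0_mulye ?lte_fin.
have L : \sum_z fine (potential x z) * ((p h z y - p 0 z y) / h) @[h --> 0^'+]
    --> \sum_z fine (potential x z) * q z y.
  apply: cvg_big => // [|z _]; first exact: add_continuous.
  by apply: cvgM; [exact: cvg_cst|exact: gen].
have M : - (fine (sojourn `[0%R, h[ x y) / h) @[h --> 0^'+] --> (- (x == y)%:R : R).
  by apply: cvgN; exact: sojourn_rate.
apply: (cvg_unique _ L) => //.
apply: cvg_trans M; apply: near_eq_cvg; near=> h.
have h0 : 0 < h by near: h; exact: nbhs_right_gt.
under eq_bigr do rewrite mulrA mulrBr mulrBl.
rewrite sumrB -!mulr_suml !addr ?(ltW h0)//.
rewrite [sojourn `[0, 0[ x y]/sojourn set_itvco0 integral_set0/= subr0.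
by rewrite -mulrBl addrAC subrr sub0r mulNr.
Unshelve. all: end_near. Qed.

(** A positive [p t x y] would stay bounded below on an interval by continuity,
    and so contribute to the potential. *)
Lemma potential_eq0 x y : potential x y = 0%E ->
  forall t, 0 <= t -> p t x y = 0.
Proof.
move=> G0 t t0; apply/eqP; rewrite eq_le (transition_ge0 p_tf)// andbT leNgt.
apply/negP => pt.
have [c c0 Hc] := transition_equicontinuous _ (divr_gt0 pt (ltr0n _ 2)).
have : (0 < potential x y)%E; last by rewrite G0 ltxx.
apply: (@lt_le_trans _ _ (\int[mu]_(s in `[t, (t + c)%R[) cst (p t x y / 2)%:E s)%E).
  rewrite integral_cst//= lebesgue_measure_itv/= lte_fin ltrDl c0.
  by rewrite -EFinD -EFinM lte_fin addrAC subrr add0r mulr_gt0// divr_gt0.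
apply: (@le_trans _ _ (sojourn `[t, (t + c)%R[ x y)).
  apply: ge0_le_integral => //.
  - by move=> s _; rewrite lee_fin divr_ge0// ltW.
  - apply: measurable_transition => // s /=; rewrite in_itv => /andP[+ _].
    exact: le_trans.
  - move=> s /=; rewrite in_itv => /andP[ts stc]; rewrite lee_fin.
    have := Hc t s x y t0 (le_trans t0 ts).
    rewrite ger0_norm ?subr_ge0// ltrBlDl => /(_ stc).
    by rewrite ltr_norml => /andP[? _]; lra.
apply: ge0_subset_integral => //=.
- by apply: measurable_transition => // s /=; rewrite in_itv => /andP[].
- by move=> s; rewrite in_itv => /andP[s0 _]; exact: transition_ge0_ereal.
- by move=> s /=; rewrite !in_itv/= => /andP[/(le_trans t0) ->].
Qed.

End TransitionFunction.

(** * Occupation times of a Markov jump process *)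

Section JumpProcess.
Context {R : realType} {E : finType} {p : R -> E -> E -> R}.
Context {d : measure_display} {U : measurableType d} {Q : probability U R}.
Context {phi : R -> U -> E}.
Hypothesis p_tf : transition_function p.
Hypothesis p_std : forall x y, p t x y @[t --> 0^'+] --> ((x == y)%:R : R).
Hypothesis phi_mjp : Markov_jump_process Q phi p.

Let mu := @lebesgue_measure R.

Definition visits (x : E) : set (R * U) :=
  [set z | 0 <= z.1 /\ phi z.1 z.2 = x].

(** Joint measurability of the process. With t approximated from the right by
    the next multiple of 1/(m+1), right-continuity says that phi_t(w) = x if and
    only if the approximations are eventually equal to x; each of them involves
    countably many times only. *)
Lemma visitsE x : visits x = \bigcup_M \bigcap_(m in [set m | (M <= m)%N])
  \bigcup_j (`[j%:R / m.+1%:R, j.+1%:R / m.+1%:R[%classic `*`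
             [set w | phi (j.+1%:R / m.+1%:R) w = x]).
Proof.
(* A sample path is constant on some [t, t + c[, which contains all the
   approximations of mesh below [c]. *)
have rc t w : 0 <= t -> exists2 c : R, 0 < c &
    forall m j, (Num.bound c^-1 <= m)%N -> t \in `[j%:R / m.+1%:R, j.+1%:R / m.+1%:R[ ->
    phi (j.+1%:R / m.+1%:R) w = phi t w.
  move=> t0; have [c /= c0 Hc] := mjp_right_continuous phi_mjp w t0.
  exists c => // m j cm; rewrite in_itv/= => /andP[jt tj]; apply: Hc => //=.
  rewrite ltr0_norm ?subr_lt0// opprB ltrBlDl.
  apply: (@le_lt_trans _ _ (t + m.+1%:R^-1)).
    by rewrite -natr1 mulrDl mul1r lerD2r.
  rewrite ltrD2l invf_plt ?posrE ?ltr0n//.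
  have ci : 0 <= c^-1 by rewrite invr_ge0 ltW.
  by apply: lt_le_trans (archi_boundP ci) _; rewrite ler_nat leqW.
apply/seteqP; split => -[t w] /=.
  move=> [t0 phix]; have [c c0 Hc] := rc t w t0.
  exists (Num.bound c^-1) => // m /= cm; pose j := Num.truncn (t * m.+1%:R).
  have m0 : 0 < m.+1%:R :> R by rewrite ltr0n.
  have tj : t \in `[j%:R / m.+1%:R, j.+1%:R / m.+1%:R[.
    have /andP[? ?] := truncn_itv (mulr_ge0 t0 (ltW m0)).
    by rewrite in_itv/= ler_pdivrMr// ltr_pdivlMr// /j; apply/andP.
  by exists j => //; split => //=; rewrite (Hc m j).
move=> [M _ HM].
have t0 : 0 <= t.
  have [j _ [/= + _]] := HM M (leqnn M).
  by rewrite in_itv/= => /andP[+ _]; apply: le_trans; rewrite divr_ge0.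
split=> //; have [c c0 Hc] := rc t w t0.
have [j _ [/= tj <-]] := HM (maxn M (Num.bound c^-1)) (leq_maxl _ _).
by rewrite (Hc (maxn M (Num.bound c^-1)) j)// leq_maxr.
Qed.

Lemma measurable_visits x : measurable (visits x).
Proof.
rewrite visitsE; apply: bigcupT_measurable => M.
apply: bigcap_measurable; first by exists M => /=.
move=> m _; apply: bigcupT_measurable => j; apply: measurableX => //.
by apply: (mjp_measurable phi_mjp); rewrite divr_ge0.
Qed.

Definition occupation (x : E) (w : U) : \bar R :=
  (\int[mu]_(t in `[0%R, +oo[) ((phi t w == x)%:R)%:E)%E.

Lemma occupationE x w :
  occupation x w = (\int[mu]_t (\1_(visits x) (t, w))%:E)%E.
Proof.
rewrite /occupation integral_mkcond; apply: eq_integral => t _.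
rewrite patchE indicE; have [|] := boolP (t \in _).
  rewrite inE/= in_itv/= andbT => t0; congr (_%:R%:E); congr nat_of_bool.
  by apply/eqP/idP => [?|/set_mem[]//]; rewrite inE.
rewrite notin_setE/= in_itv/= andbT => t0.
by rewrite memNset// => -[].
Qed.

Let mvis x : measurable_fun [set: measurableTypeR R * U]
  (fun z => (\1_(visits x) z)%:E : \bar R).
Proof. by apply/measurable_EFinP; apply: measurable_indic; exact: measurable_visits. Qed.

Lemma measurable_occupation x : measurable_fun [set: U] (occupation x).
Proof.
rewrite (_ : occupation x = fubini_G mu (fun z => (\1_(visits x) z)%:E)).
  by apply: measurable_fun_fubini_tonelli_G => [|z]; [exact: mvis|rewrite lee_fin].
by apply/funext => w; rewrite occupationE.
Qed.

(** Sections of the jointly measurable set [visits x]. *)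
Lemma measurable_path x w : measurable_fun (`[0%R, +oo[%classic : set R)
  (fun t => ((phi t w == x)%:R)%:E : \bar R).
Proof.
have mt : measurable_fun [set: measurableTypeR R]
    (fun t => (\1_(visits x) (t, w))%:E : \bar R).
  by apply: measurableT_comp (mvis x) _; exact: measurable_pair2.
apply: eq_measurable_fun (measurable_funTS mt) => t.
rewrite inE/= in_itv/= andbT => t0.
rewrite indicE; congr (_%:R%:E); congr nat_of_bool.
by apply/idP/eqP => [/set_mem[]//|?]; rewrite inE.
Qed.

Lemma occupation_sum (a : pred E) w :
  (\int[mu]_(t in `[0%R, +oo[) ((a (phi t w))%:R)%:E
   = \sum_(x | a x) occupation x w)%E.
Proof.
under eq_integral => t _.
  rewrite (_ : _%:E = (\sum_(x <- enum a) ((phi t w == x)%:R)%:E)%E); last first.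
    rewrite big_enum/= sumEFin; congr EFin.
    have [aphi|aphi] := boolP (a (phi t w)).
      rewrite (bigD1 (phi t w))//= eqxx big1 ?addr0// => x /andP[_].
      by rewrite eq_sym => /negbTE ->.
    by rewrite big1// => x ax; case: eqP => // e; rewrite e (ax : a x) in aphi.
  over.
rewrite ge0_integral_sum//; first by rewrite big_enum.
by move=> x; exact: measurable_path.
Qed.

Lemma occupation_ge0 x w : (0 <= occupation x w)%E.
Proof. by rewrite integral_ge0// => t _; rewrite lee_fin. Qed.

(** The Markov property with an empty history. *)
Lemma law_pair s t x y : 0 <= s -> 0 <= t ->
  (Q ([set w | phi s w = x] `&` [set w | phi (s + t)%R w = y])
   = (p t x y)%:E * Q [set w | phi s w = x])%E.
Proof.
move=> s0 t0.
have pastT :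
    [set w | forall u, u \in ([::] : seq (R * E)) -> phi u.1 w = u.2] = setT.
  by apply/seteqP; split.
have := @mjp_Markov _ _ _ _ _ _ _ phi_mjp s t x y [::] s0 t0 => /=.
by rewrite pastT setIT setIC; exact.
Qed.

Lemma law_partition t x : 0 <= t ->
  (Q [set w | phi t w = x] = \sum_z (p t z x)%:E * Q [set w | phi 0%R w = z])%E.
Proof.
move=> t0.
have m0 z : measurable [set w | phi 0 w = z] by exact: (mjp_measurable phi_mjp).
have mt : measurable [set w | phi t w = x] by exact: (mjp_measurable phi_mjp).
transitivity (\int[Q]_(w in setT) (\1_[set w | phi t w = x] w)%:E)%E.
  by rewrite integral_indic// setIT.
transitivity (\int[Q]_(w in setT) \sum_z
    (\1_([set w | phi 0%R w = z] `&` [set w | phi t w = x]) w)%:E)%E.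
  apply: eq_integral => w _; rewrite (bigD1 (phi 0 w))//= big1 => [|z zw].
    rewrite adde0 !indicE; congr (_%:R%:E); congr nat_of_bool.
    by apply/idP/idP => [/set_mem H|/set_mem[_ H]]; exact/mem_set.
  by rewrite indicE memNset// => -[/= zE _]; rewrite zE eqxx in zw.
rewrite ge0_integral_sum//.
- apply: eq_bigr => z _; rewrite integral_indic//; last exact: measurableI.
  by rewrite setIT -law_pair// add0r.
- by move=> z; apply/measurable_EFinP; apply: measurable_indic; exact: measurableI.
Qed.

Let visits_law t x : 0 <= t ->
  (\int[Q]_w (\1_(visits x) (t, w))%:E = Q [set w | phi t w = x])%E.
Proof.
move=> t0; rewrite -[X in Q X]setIT -integral_indic//; last first.
  exact: (mjp_measurable phi_mjp).
apply: eq_integral => w _; rewrite !indicE; congr (_%:R%:E); congr nat_of_bool.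
by apply/idP/idP => /set_mem H; rewrite inE//=; case: H.
Qed.

Let visits_law_neg t x : t < 0 ->
  (\int[Q]_w (\1_(visits x) (t, w))%:E = 0)%E.
Proof.
move=> t0; apply: integral0_eq => w _.
by rewrite indicE memNset// => -[/=]; rewrite leNgt t0.
Qed.

(** Tonelli's theorem, followed by conditioning on the initial state. *)
Lemma expected_occupation x : (\int[Q]_w occupation x w =
  \sum_z Q [set w | phi 0%R w = z] * potential (p := p) z x)%E.
Proof.
under eq_integral do rewrite occupationE.
rewrite -(fubini_tonelli (m1 := mu) (m2 := Q) _ (mvis x)); last first.
  by move=> z; rewrite lee_fin.
transitivity (\int[mu]_(t in `[0%R, +oo[) Q [set w | phi t w = x])%E.
  rewrite [RHS]integral_mkcond; apply: eq_integral => t _.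
  rewrite patchE; case: ifPn => [|].
    by rewrite inE/= in_itv/= andbT => t0; rewrite visits_law.
  rewrite notin_setE/= in_itv/= andbT => /negP; rewrite -ltNge.
  exact: visits_law_neg.
under eq_integral => t.
  rewrite inE/= in_itv/= andbT => t0.
  rewrite law_partition//.
  under eq_bigr do rewrite muleC.
  over.
have mp z : measurable_fun (`[0%R, +oo[%classic : set R) (fun t => (p t z x)%:E).
  by apply: measurable_transition => // t /=; rewrite in_itv => /andP[].
rewrite ge0_integral_sum//.
- apply: eq_bigr => z _; rewrite ge0_integralZl//; first exact: mp.
  by move=> t /=; rewrite in_itv andbT; exact: transition_ge0_ereal.
- by move=> z; apply: measurable_funeM; exact: mp.
- move=> z t /=; rewrite in_itv andbT => t0.
  by rewrite mule_ge0// transition_ge0_ereal.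
Qed.

(** The probability of being in [x] at time [s] and in [y] at time [t], written as
    an integral of indicators so that it vanishes at negative times. *)
Let joint x y s t :=
  (\int[Q]_w ((\1_(visits x) (s, w))%:E * (\1_(visits y) (t, w))%:E))%E.

Let joint_neg x y s t : (s < 0) || (t < 0) -> joint x y s t = 0%E.
Proof.
move=> neg; apply: integral0_eq => w _; case/orP: neg => st0.
  by rewrite indicE memNset ?mul0e//= => -[/=]; rewrite leNgt st0.
by rewrite [X in (_ * X)%E](_ : _ = 0%E) ?mule0// indicE memNset//= => -[/=];
  rewrite leNgt st0.
Qed.

Let jointE x y s t : 0 <= s -> 0 <= t ->
  joint x y s t = Q ([set w | phi s w = x] `&` [set w | phi t w = y]).
Proof.
move=> s0 t0; rewrite -[X in Q X]setIT -integral_indic//; last first.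
  by apply: measurableI; exact: (mjp_measurable phi_mjp).
apply: eq_integral => w _; rewrite -EFinM; congr EFin.
rewrite -[RHS]/(\1_([set w | phi s w = x] `&` [set w | phi t w = y]) w).
rewrite indicI; congr (_ * _); rewrite !indicE; congr (_%:R); congr nat_of_bool;
  by apply/idP/idP => /set_mem H; rewrite inE//=; case: H.
Qed.

(** If [y] never leads to [x], then only the pairs of times [s <= t] count in
    the double time integral of [joint x y s t], and the Markov property at time
    [s] separates the two occupation times. *)
Lemma expected_occupation_product x y : potential (p := p) y x = 0%E ->
  (\int[Q]_w (occupation x w * occupation y w)
   = (\int[Q]_w occupation x w) * potential (p := p) x y)%E.
Proof.
move=> G0.
have ind0 z s w : (0 <= (\1_(visits z) (s, w))%:E :> \bar R)%E by rewrite lee_fin.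
have p0 := potential_eq0 p_tf p_std _ _ G0.
have mvw z w : measurable_fun [set: measurableTypeR R]
    (fun t => (\1_(visits z) (t, w))%:E : \bar R).
  by apply: measurableT_comp (mvis z) _; exact: measurable_pair2.
have mvt z t : measurable_fun [set: U] (fun w => (\1_(visits z) (t, w))%:E : \bar R).
  by apply: measurableT_comp (mvis z) _; exact: measurable_pair1.
have mJ s : measurable_fun [set: measurableTypeR R * U]
    (fun z => (\1_(visits x) (s, z.2))%:E * (\1_(visits y) z)%:E : \bar R)%E.
  have m1 : measurable_fun [set: measurableTypeR R * U]
      (fun z => (\1_(visits x) (s, z.2))%:E : \bar R).
    by apply: measurableT_comp (mvt x s) _; exact: measurable_snd.
  exact: emeasurable_funM m1 (mvis y).
have mjoint s : measurable_fun [set: measurableTypeR R] (joint x y s).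
  apply: (measurable_fun_fubini_tonelli_F (m2 := Q) _ (mJ s)).
  by move=> [t w]; rewrite mule_ge0.
have joint0 s t : (0 <= joint x y s t)%E.
  by apply: integral_ge0 => w _; rewrite mule_ge0.
have mp z : measurable_fun (`[0%R, +oo[%classic : set R) (fun t => (p t z y)%:E).
  by apply: measurable_transition => // t /=; rewrite in_itv => /andP[].
have inner s : (\int[mu]_t joint x y s t
    = (\int[Q]_w (\1_(visits x) (s, w))%:E) * potential (p := p) x y)%E.
  have [s0|s0] := ltP s 0.
    rewrite integral0_eq => [|t _]; last by rewrite joint_neg ?s0.
    by rewrite visits_law_neg// mul0e.
  rewrite visits_law//.
  transitivity (\int[mu]_(t in `[s, +oo[) joint x y s t)%E.
    rewrite [RHS]integral_mkcond; apply: eq_integral => t _.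
    rewrite patchE; case: ifPn => //.
    rewrite notin_setE/= in_itv/= andbT => /negP; rewrite -ltNge => ts.
    have [t0|t0] := ltP t 0; first by rewrite joint_neg ?t0 ?orbT.
    have st0 : 0 <= s - t by rewrite subr_ge0 ltW.
    by rewrite jointE// setIC -{1}(subrKC t s) law_pair// p0// mul0e.
  rewrite (ge0_integral_shift s)//; last by apply: measurable_funTS; exact: mjoint.
  transitivity (\int[mu]_(t in `[0%R, +oo[) (Q [set w | phi s w = x] * (p t x y)%:E))%E.
    rewrite [X in integral _ X](_ : _ = `[0, +oo[%classic); last first.
      by apply/seteqP; split => t /=; rewrite !in_itv/= lerDl.
    apply: eq_integral => t; rewrite inE/= in_itv/= andbT => t0.
    by rewrite jointE ?addr_ge0// law_pair// muleC.
  rewrite ge0_integralZl//; first exact: mp.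
  by move=> t /=; rewrite in_itv andbT; exact: transition_ge0_ereal.
transitivity (\int[Q]_w \int[mu]_s ((\1_(visits x) (s, w))%:E * occupation y w))%E.
  apply: eq_integral => w _; rewrite {1}occupationE ge0_integralZr//.
  exact: occupation_ge0.
rewrite -(fubini_tonelli (m1 := mu) (m2 := Q)
  (fun z => (\1_(visits x) z)%:E * occupation y z.2)%E); last 2 first.
- have m2 : measurable_fun [set: measurableTypeR R * U] (fun z => occupation y z.2).
    by apply: measurableT_comp (measurable_occupation y) _; exact: measurable_snd.
  exact: (emeasurable_funM (mvis x) m2).
- by move=> [s w]; rewrite mule_ge0//; exact: occupation_ge0.
transitivity (\int[mu]_s \int[mu]_t joint x y s t)%E.
  apply: eq_integral => s _ /=.
  rewrite (fubini_tonelli (m1 := mu) (m2 := Q) _ (mJ s)); last first.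
    by move=> [t w]; rewrite mule_ge0.
  apply: eq_integral => w _ /=; rewrite ge0_integralZl//.
  by rewrite -occupationE.
under eq_integral do rewrite inner.
rewrite ge0_integralZr//; last 3 first.
- apply: (measurable_fun_fubini_tonelli_F (m2 := Q) _ (mvis x)).
  by move=> [t w]; exact: ind0.
- by move=> s _; apply: integral_ge0 => w _; exact: ind0.
- by apply: (sojourn_ge0 p_tf) => t /=; rewrite in_itv => /andP[].
rewrite (fubini_tonelli (m1 := mu) (m2 := Q) _ (mvis x)); last first.
  by move=> [t w]; exact: ind0.
by congr (_ * _)%E; apply: eq_integral => w _; rewrite occupationE.
Qed.

End JumpProcess.

(** * Potential of a block bidiagonal generator *)

Section Blocks.
Context {R : realType} {n : nat} {d : nat -> nat}.
Variables (A : forall k, 'M[R]_(d k)) (D : forall k, 'M[R]_(d k, d k.+1)).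

Lemma passage_diag k : passage A D k k = 1%:M.
Proof.
by case: k => [|k] /=; case: eqP => // e; rewrite (eq_irrelevance e erefl) castmx_id.
Qed.

Lemma passage_succ k l : k != l.+1 ->
  passage A D k l.+1 = passage A D k l *m invmx (- A l) *m D l.
Proof. by move=> /= /eqP; case: eqP. Qed.

(** The value 0 below the diagonal is the true one for the potential, which lets
    [block_passage] be stated for all pairs of phases at once. *)
Lemma passage_gt k l : (l < k)%N -> passage A D k l = 0.
Proof.
elim: l => [|l IH] lk /=; case: eqP => // e; first by rewrite e ltnn in lk.
  by rewrite e ltnn in lk.
by rewrite IH ?mul0mx// ltnW.
Qed.

(** [passage] is defined by its last step; this peels off the first one. *)
Lemma passage_first k l : (k < l)%N ->
  passage A D k l = invmx (- A k) *m D k *m passage A D k.+1 l.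
Proof.
elim: l => // l IH; rewrite ltnS leq_eqVlt => /predU1P[<-|kl].
  by rewrite passage_succ ?neq_ltn ?ltnSn// !passage_diag mul1mx mulmx1.
rewrite !passage_succ ?neq_ltn ?ltnS ?kl ?(ltnW kl)// IH//.
by rewrite !mulmxA.
Qed.

Definition in_phase (k : 'I_n) (i : 'I_(d k)) : state n d :=
  Some (existT (fun k : 'I_n => 'I_(d k)) k i).

(** A state whose phase is given as a natural number with a bound, the form that
    suits induction on the phase and the dimensions [d k]. *)
Definition phase_state {k} (hk : (k < n)%N) (i : 'I_(d k)) : state n d :=
  in_phase (Ordinal hk) i.

Lemma phase_state_inj k (hk : (k < n)%N) : injective (phase_state hk).
Proof. by move=> i j /Some_inj/eqP; rewrite eq_Tagged/= => /eqP. Qed.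

Lemma sum_state (V : nmodType) (F : state n d -> V) : \sum_z F z =
  F None + \sum_(k < n) \sum_(i < d k) F (in_phase k i).
Proof.
rewrite (bigD1 None)//=; congr (_ + _).
rewrite (reindex_omap Some id)/=; last by case.
rewrite sig_big_dep/=; apply: eq_big => [x|[] //].
by rewrite eqxx.
Qed.

Lemma sum_phase (V : nmodType) (F : state n d -> V) (k : 'I_n) :
  \sum_(z | phase z == Some k) F z = \sum_(i < d k) F (in_phase k i).
Proof.
rewrite big_mkcond sum_state/= add0r (bigD1 k)//= [X in _ + X]big1 ?addr0 => [|m mk].
  by apply: eq_bigr => i _; rewrite eqxx.
by apply: big1 => i _; rewrite /phase/= (inj_eq Some_inj) (negbTE mk).
Qed.

Lemma rate_within {k} (hk : (k < n)%N) i j :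
  mph_rate A D (phase_state hk i) (phase_state hk j) = A k i j.
Proof.
rewrite /=; case: eqP => // e.
by rewrite (eq_irrelevance e erefl) cast_ord_id.
Qed.

Lemma rate_next {k} (hk : (k < n)%N) (hk1 : (k.+1 < n)%N) i j :
  mph_rate A D (phase_state hk i) (phase_state hk1 j) = D k i j.
Proof.
rewrite /=; case: eqP => [e|_]; first by case: (n_Sn k).
case: eqP => // e.
by rewrite (eq_irrelevance e erefl) cast_ord_id.
Qed.

Lemma rate_other {k l} (hk : (k < n)%N) (hl : (l < n)%N) i j :
  l != k -> l != k.+1 -> mph_rate A D (phase_state hk i) (phase_state hl j) = 0.
Proof. by move=> /eqP lk /eqP lk1 /=; case: eqP => //; case: eqP. Qed.

Variable G : state n d -> state n d -> R.
Hypothesis G_rate : forall x y, y != None ->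
  \sum_z G x z * mph_rate A D z y = - (x == y)%:R.

Definition block {k l} (hk : (k < n)%N) (hl : (l < n)%N) : 'M[R]_(d k, d l) :=
  \matrix_(i, j) G (phase_state hk i) (phase_state hl j).

Let delta {k l} (hk : (k < n)%N) (hl : (l < n)%N) : 'M[R]_(d k, d l) :=
  \matrix_(i, j) (phase_state hk i == phase_state hl j)%:R.

Let delta_neq k l (hk : (k < n)%N) (hl : (l < n)%N) : k != l -> delta hk hl = 0.
Proof.
move=> /eqP kl; apply/matrixP => i j; rewrite !mxE; case: eqP => // e.
by have [] : Some (Ordinal hk) = Some (Ordinal hl) := congr1 (@phase n d) e.
Qed.

Let deltaE k l (hk : (k < n)%N) (hl : (l < n)%N) : (l <= k)%N ->
  delta hk hl = passage A D k l.
Proof.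
rewrite leq_eqVlt => /predU1P[e|lk].
  case: k / e hk => hk; rewrite (bool_irrelevance hk hl) passage_diag.
  apply/matrixP => i j; rewrite !mxE; congr (_%:R); congr nat_of_bool.
  by apply/eqP/eqP => [/phase_state_inj|->].
by rewrite passage_gt// delta_neq// neq_ltn lk orbT.
Qed.

(** The part of the column sum of G q that comes from phase [m]; by the shape of
    the rates only the phase of the column and the preceding one contribute. *)
Let flow x {l} (hl : (l < n)%N) j (m : 'I_n) : R :=
  \sum_(i < d m) G x (in_phase m i) * mph_rate A D (in_phase m i) (phase_state hl j).

Let sum_flow x {l} (hl : (l < n)%N) j :
  \sum_m flow x hl j m = - (x == phase_state hl j)%:R.
Proof. by rewrite -G_rate// sum_state mulr0 add0r. Qed.

Let flow_within k l (hk : (k < n)%N) (hl : (l < n)%N) i j :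
  flow (phase_state hk i) hl j (Ordinal hl) = (block hk hl *m A l) i j.
Proof.
rewrite !mxE; apply: eq_bigr => z _.
by rewrite !mxE -(rate_within hl).
Qed.

Let flow_next k l (hk : (k < n)%N) (hl : (l < n)%N) (hl1 : (l.+1 < n)%N) i j :
  flow (phase_state hk i) hl1 j (Ordinal hl) = (block hk hl *m D l) i j.
Proof.
rewrite !mxE; apply: eq_bigr => z _.
by rewrite !mxE -(rate_next hl hl1).
Qed.

Let flow_other x l (hl : (l < n)%N) j (m : 'I_n) :
  (m : nat) != l -> m.+1 != l -> flow x hl j m = 0.
Proof.
case: m => m hm /= ml m1l; rewrite /flow big1// => i _.
by rewrite -/(phase_state hm i) rate_other ?mulr0 1?eq_sym.
Qed.

Let block0 k (hk : (k < n)%N) (h0 : (0 < n)%N) :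
  block hk h0 *m - A 0%N = delta hk h0.
Proof.
apply/matrixP => i j; have := sum_flow (phase_state hk i) h0 j.
rewrite (bigD1 (Ordinal h0))//= big1 => [|m m0]; last exact: flow_other.
by rewrite addr0 flow_within mulmxN !mxE => ->; rewrite opprK.
Qed.

Let blockS k l (hk : (k < n)%N) (hl : (l < n)%N) (hl1 : (l.+1 < n)%N) :
  block hk hl1 *m - A l.+1 = delta hk hl1 + block hk hl *m D l.
Proof.
apply/matrixP => i j; have := sum_flow (phase_state hk i) hl1 j.
rewrite (bigD1 (Ordinal hl1))//= (bigD1 (Ordinal hl))/=; last first.
  by rewrite -val_eqE/= neq_ltn ltnSn.
rewrite big1 => [|m]; last first.
  by rewrite -!val_eqE/= => /andP[ml1 ml]; exact: flow_other.
rewrite addr0 flow_within flow_next mulmxN => e.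
rewrite [LHS]mxE [RHS]mxE [delta _ _ _ _]mxE.
by apply/eqP; rewrite -subr_eq0 -[_%:R]opprK -e; apply/eqP; ring.
Qed.

(** Blockwise, G q = - 1 reads G_(k,l) (- A_l) = delta_(k,l) + G_(k,l-1) D_(l-1),
    which determines the blocks by induction on [l]. The diagonal block is a left
    inverse of - A_l, because the block to its left vanishes; this gives the
    invertibility of A_l at the same stage. *)
Lemma block_passage k l (hk : (k < n)%N) (hl : (l < n)%N) :
  (- A l \in unitmx) /\ block hk hl = passage A D k l *m invmx (- A l).
Proof.
have step m (hm : (m < n)%N) :
    (forall k' (hk' : (k' < n)%N), block hk' hm *m - A m = passage A D k' m) ->
  - A m \in unitmx /\
    forall k' (hk' : (k' < n)%N), block hk' hm = passage A D k' m *m invmx (- A m).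
  move=> H; have uA : - A m \in unitmx.
    by have := H m hm; rewrite passage_diag => /mulmx1_unit[].
  by split=> // k' hk'; rewrite -H mulmxK.
suff H m (hm : (m < n)%N) k' (hk' : (k' < n)%N) :
    block hk' hm *m - A m = passage A D k' m.
  by have [uA e] := step l hl (H l hl); split; last exact: e.
elim: m hm k' hk' => [|m IH] hm k' hk'; first by rewrite block0 deltaE.
have hm' := ltnW hm.
have [_ e] := step m hm' (IH hm').
rewrite (blockS _ _ _ hm') e.
have [k'm|mk'] := leqP m.+1 k'.
  by rewrite deltaE// (@passage_gt k' m)// !mul0mx addr0.
have km : k' != m.+1 by rewrite neq_ltn mk'.
by rewrite passage_succ// delta_neq// add0r.
Qed.

Lemma potential_entry (k l : 'I_n) i j :
  G (in_phase k i) (in_phase l j) = (passage A D k l *m invmx (- A l)) i j.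
Proof.
case: k l i j => [k hk] [l hl] i j.
by have [_ <-] := block_passage k l hk hl; rewrite mxE.
Qed.

End Blocks.

(** * Moments determined by the joint law *)

Section SameLaw.
Context {R : realType} {n : nat}.
Context {dT : measure_display} {T : measurableType dT} {P : probability T R}.
Context {dU : measure_display} {U : measurableType dU} {Q : probability U R}.
Variables (Y : 'I_n -> {RV P >-> R}) (Z : 'I_n -> U -> \bar R).
Hypothesis mZ : forall k, measurable_fun [set: U] (Z k).
Hypothesis Z0 : forall k w, (0 <= Z k w)%E.
Hypothesis same_law : forall B : set (n.-tuple (\bar R)), measurable B ->
  P [set w | B [tuple (Y k w)%:E | k < n]] = Q [set w | B [tuple Z k w | k < n]].

Let Yt w := [tuple (Y k w)%:E | k < n].
Let Zt w := [tuple Z k w | k < n].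

Let mYt : measurable_fun [set: T] Yt.
Proof.
apply/measurable_fun_tnthP => k.
rewrite (_ : _ \o _ = EFin \o Y k); last by apply/funext => w /=; rewrite tnth_mktuple.
exact/measurable_EFinP.
Qed.

Let mZt : measurable_fun [set: U] Zt.
Proof.
apply/measurable_fun_tnthP => k.
by rewrite (_ : _ \o _ = Z k)//; apply/funext => w /=; rewrite tnth_mktuple.
Qed.

(** Both integrals are over the image measure on tuples. *)
Lemma same_law_integral (f : n.-tuple (\bar R) -> \bar R) :
    measurable_fun [set: n.-tuple (\bar R)] f -> (forall t, 0 <= f t)%E ->
  (\int[P]_w f [tuple (Y k w)%:E | k < n] = \int[Q]_w f [tuple Z k w | k < n])%E.
Proof.
move=> mf f0.
have := @ge0_integral_pushforward _ _ _ _ R _ mYt P _ f measurableT mf (fun t _ => f0 t).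
have := @ge0_integral_pushforward _ _ _ _ R _ mZt Q _ f measurableT mf (fun t _ => f0 t).
rewrite !preimage_setT => <- <-.
by apply: eq_measure_integral => B mB _; exact: same_law.
Qed.

Let Y_ge0 k : {ae P, forall w, 0 <= Y k w}.
Proof.
pose B := [set t : n.-tuple (\bar R) | (tnth t k < 0)%E].
have mB : measurable B.
  rewrite (_ : B = (fun t => tnth t k) @^-1` `]-oo, 0%E[%classic); last first.
    by apply/seteqP; split => t; rewrite /B/= in_itv.
  rewrite -[X in measurable X]setTI; apply: measurable_tnth => //.
  exact: emeasurable_itv.
exists [set w | B (Yt w)]; split.
- by rewrite -[X in measurable X]setTI; exact: mYt.
- rewrite same_law// (_ : [set w | _] = set0) ?measure0//.
  by apply/seteqP; split => // w; rewrite /B/= tnth_mktuple ltNge Z0.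
- move=> w /= /negP; rewrite -ltNge => Yw.
  by rewrite /B /Yt/= tnth_mktuple lte_fin.
Qed.

(** The law controls nonnegative integrands only; absolute values give
    integrability, and almost sure nonnegativity removes them. *)
Let Lfun_of_law (X : T -> R) (W : U -> \bar R) (m : R) :
    measurable_fun [set: T] X -> {ae P, forall w, 0 <= X w} ->
    (\int[P]_w `|(X w)%:E| = \int[Q]_w W w)%E ->
    (\int[Q]_w W w = m%:E)%E ->
  X \in Lfun P 1 /\ ('E_P[X] = m%:E)%E.
Proof.
move=> mX X0 XW Wm; split.
  apply/Lfun1_integrable; apply/integrableP; split; first exact/measurable_EFinP.
  by rewrite XW Wm ltry.
rewrite unlock -Wm -XW; apply: ae_eq_integral => //.
- exact/measurable_EFinP.
- by apply: measurableT_comp => //; exact/measurable_EFinP.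
- by apply: filterS X0 => w X0 _; rewrite /= ger0_norm.
Qed.

Lemma same_law_covariance k l (a b c : R) :
    (\int[Q]_w Z k w = a%:E)%E -> (\int[Q]_w Z l w = b%:E)%E ->
    (\int[Q]_w (Z k w * Z l w) = c%:E)%E ->
  covariance P (Y k) (Y l) = (c - a * b)%:E.
Proof.
move=> Ea Eb Ec.
have mt m : measurable_fun [set: n.-tuple (\bar R)] (fun t => tnth t m).
  exact: measurable_tnth.
have one m : (\int[P]_w `|(Y m w)%:E| = \int[Q]_w Z m w)%E.
  have mf : measurable_fun [set: n.-tuple (\bar R)] (fun t => `|tnth t m|)%E.
    by apply: measurableT_comp => //; exact: mt.
  transitivity (\int[P]_w `|tnth [tuple (Y k w)%:E | k < n] m|)%E.
    by apply: eq_integral => w _; rewrite tnth_mktuple.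
  rewrite (same_law_integral _ mf)//.
  by apply: eq_integral => w _; rewrite tnth_mktuple gee0_abs.
have two : (\int[P]_w `|((Y k * Y l)%R w)%:E| = \int[Q]_w (Z k w * Z l w))%E.
  have mf : measurable_fun [set: n.-tuple (\bar R)]
      (fun t => `|tnth t k * tnth t l|)%E.
    by apply: measurableT_comp => //; exact: emeasurable_funM (mt k) (mt l).
  transitivity (\int[P]_w `|tnth [tuple (Y k w)%:E | k < n] k
      * tnth [tuple (Y k w)%:E | k < n] l|)%E.
    by apply: eq_integral => w _; rewrite !tnth_mktuple.
  rewrite (same_law_integral _ mf)//.
  by apply: eq_integral => w _; rewrite !tnth_mktuple gee0_abs// mule_ge0.
have [Lk Ek] := Lfun_of_law _ _ _ (measurable_funP (Y k)) (Y_ge0 k) (one k) Ea.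
have [Ll El] := Lfun_of_law _ _ _ (measurable_funP (Y l)) (Y_ge0 l) (one l) Eb.
have Ykl0 : {ae P, forall w, 0 <= (Y k * Y l) w}.
  by apply: filterS2 (Y_ge0 k) (Y_ge0 l) => w; exact: mulr_ge0.
have [Lkl Ekl] := Lfun_of_law _ _ _
  (measurable_funM (measurable_funP (Y k)) (measurable_funP (Y l))) Ykl0 two Ec.
by rewrite covarianceE// Ek El Ekl -EFinM -EFinB.
Qed.

End SameLaw.

(** * Moments of the phase durations *)

Section OccupationMoments.
Context {R : realType} {n : nat} {d : nat -> nat}.
Context {alpha : 'rV[R]_(d 0%N)} {A : forall k, 'M[R]_(d k)}.
Context {D : forall k, 'M[R]_(d k, d k.+1)}.
Context {dU : measure_display} {U : measurableType dU} {Q : probability U R}.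
Context {phi : R -> U -> state n d} {p : R -> state n d -> state n d -> R}.
Hypothesis n_gt0 : (0 < n)%N.
Hypothesis p_tf : transition_function p.
Hypothesis p_gen : generator p (mph_rate A D (n := n)).
Hypothesis p_transient : forall x, x != None -> transient p x.
Hypothesis phi_mjp : Markov_jump_process Q phi p.
Hypothesis phi_init : forall x, Q [set w | phi 0%R w = x] = (mph_initial alpha x)%:E.

Let p_std := standard_of_generator p_tf _ p_gen.

Let G x y : R := fine (potential (p := p) x y).

Let potential_fin x y : y != None -> potential (p := p) x y = (G x y)%:E.
Proof.
move=> y0; rewrite fineK// ge0_fin_numE.
  apply: le_lt_trans (potential_le p_tf p_std x y) _.
  by rewrite lte_add_pinfty ?ltry//; exact: p_transient.
by apply: (sojourn_ge0 p_tf) => t /=; rewrite in_itv => /andP[].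
Qed.

Let G_rate x y : y != None ->
  \sum_z G x z * mph_rate A D z y = - (x == y)%:R.
Proof.
move=> y0; apply: (potential_generator p_tf p_std) => //.
by rewrite potential_fin// ltry.
Qed.

Let G_entry := potential_entry A D G G_rate.

Let occupation_phase (k : 'I_n) w : occupation_time phi k w
  = (\sum_(i < d k) occupation (phi := phi) (in_phase k i) w)%E.
Proof.
rewrite -(sum_phase _ (occupation (phi := phi) ^~ w)) -(occupation_sum phi_mjp).
by [].
Qed.

Lemma measurable_occupation_time k :
  measurable_fun [set: U] (occupation_time phi k).
Proof.
rewrite (_ : occupation_time phi k = fun w =>
  (\sum_(i < d k) occupation (phi := phi) (in_phase k i) w)%E); last first.
  by apply/funext => w; exact: occupation_phase.
by apply: emeasurable_sum => i; exact: (measurable_occupation phi_mjp).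
Qed.

Let mean_state (k : 'I_n) i :
  (\int[Q]_w occupation (phi := phi) (in_phase k i) w
   = ((entrance alpha A D k *m invmx (- A k)) 0 i)%:E)%E.
Proof.
rewrite (expected_occupation p_tf p_std phi_mjp).
under eq_bigr => z _ do rewrite phi_init potential_fin//.
under eq_bigr => z _ do rewrite -EFinM.
rewrite sumEFin sum_state mul0r add0r; congr EFin.
rewrite (bigD1 (Ordinal n_gt0))//= [X in _ + X]big1 ?addr0; last first.
  move=> m m0; apply: big1 => j _.
  case: eqP => [e|_]; last by rewrite mul0r.
  by rewrite -val_eqE/= e in m0.
rewrite /entrance -mulmxA mxE; apply: eq_bigr => j _.
rewrite -(G_entry (Ordinal n_gt0)); congr (_ * _).
by case: eqP => // e; rewrite (eq_irrelevance e erefl) cast_ord_id.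
Qed.

Lemma expected_occupation_time (k : 'I_n) :
  (\int[Q]_w occupation_time phi k w
   = ((entrance alpha A D k *m invmx (- A k) *m (const_mx 1 : 'cV_(d k))) 0 0)%:E)%E.
Proof.
under eq_integral do rewrite (occupation_phase).
rewrite ge0_integral_sum//; last 2 first.
- by move=> i; exact: (measurable_occupation phi_mjp).
- by move=> i w _; exact: occupation_ge0.
under eq_bigr => i _ do rewrite mean_state.
rewrite sumEFin mxE; congr EFin; apply: eq_bigr => i _.
by rewrite [X in _ * X]mxE mulr1.
Qed.

(** The product of sums is expanded over pairs of states, with the state of the
    earlier phase as the unreachable one. *)
Lemma expected_occupation_time_product (k l : 'I_n) : (k < l)%N ->
  (\int[Q]_w (occupation_time phi k w * occupation_time phi l w)
   = ((entrance alpha A D k *m (invmx (- A k) ^+ 2) *m D k *m passage A D k.+1 l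
        *m invmx (- A l) *m (const_mx 1 : 'cV[R]_(d l))) 0 0)%:E)%E.
Proof.
move=> kl.
have mocc := measurable_occupation phi_mjp.
transitivity (\int[Q]_w \sum_(i < d k) \sum_(j < d l)
    occupation (phi := phi) (in_phase k i) w
    * occupation (phi := phi) (in_phase l j) w)%E.
  apply: eq_integral => w _; rewrite !occupation_phase.
  rewrite ge0_sume_distrl => [|i _]; last exact: occupation_ge0.
  apply: eq_bigr => i _.
  by rewrite ge0_sume_distrr// => j _; exact: occupation_ge0.
rewrite ge0_integral_sum//; last 2 first.
- by move=> i; apply: emeasurable_sum => j; exact: emeasurable_funM (mocc _) (mocc _).
- by move=> i w _; apply: sume_ge0 => j _; rewrite mule_ge0// occupation_ge0.
have -> : entrance alpha A D k *m (invmx (- A k) ^+ 2) *m D k *m passage A D k.+1 l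
    *m invmx (- A l) = entrance alpha A D k *m invmx (- A k)
      *m (passage A D k l *m invmx (- A l)).
  by rewrite (passage_first A D k l kl) expr2 -mulmxE !mulmxA.
(* this block of the potential is below the diagonal *)
have unreachable i j : potential (p := p) (in_phase l j) (in_phase k i) = 0%E.
  by rewrite potential_fin// G_entry passage_gt// mul0mx mxE.
under eq_bigr => i _.
  rewrite ge0_integral_sum//; last 2 first.
  - by move=> j; exact: emeasurable_funM (mocc _) (mocc _).
  - by move=> j w _; rewrite mule_ge0// occupation_ge0.
  under eq_bigr => j _.
    rewrite (expected_occupation_product p_tf p_std phi_mjp)//.
    rewrite mean_state potential_fin// G_entry -EFinM.
    over.
  rewrite sumEFin.
  over.
rewrite sumEFin -mulmxA mxE; congr EFin; apply: eq_bigr => i _.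
rewrite -mulr_sumr [X in _ = _ * X]mxE; congr (_ * _).
by apply: eq_bigr => j _; rewrite [X in _ = _ * X]mxE mulr1.
Qed.

End OccupationMoments.

Theorem proposition2p2 (R : realType) (n : nat) (d : nat -> nat)
    (alpha : 'rV[R]_(d 0%N)) (A : forall k : nat, 'M[R]_(d k))
    (D : forall k : nat, 'M[R]_(d k, d k.+1))
    (dT : measure_display) (T : measurableType dT) (P : probability T R)
    (Y : 'I_n -> {RV P >-> R})
    (hY : mph_distributed alpha A D Y)
    (k l : 'I_n) (hkl : (k < l)%N) :
  let gamma := entrance alpha A D in
  covariance P (Y k) (Y l) =
    ((gamma k *m (invmx (- A k) ^+ 2) *m D k *m passage A D k.+1 l
        *m invmx (- A l) *m (const_mx 1 : 'cV[R]_(d l))) 0 0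
     - (gamma k *m invmx (- A k) *m (const_mx 1 : 'cV[R]_(d k))) 0 0
       * (gamma l *m invmx (- A l) *m (const_mx 1 : 'cV[R]_(d l))) 0 0)%:E.
Proof.
move=> gamma.
have [[n0 _ _ _ _ _ _] [dU [U [Q [phi [p]]]]]] := hY.
move=> [p_tf p_gen p_tr phi_mjp [phi_init law]].
apply: (same_law_covariance _ _ _ _ law).
- exact: (measurable_occupation_time phi_mjp).
- by move=> m w; apply: integral_ge0 => t _; rewrite lee_fin.
- exact: (expected_occupation_time n0 p_tf p_gen p_tr phi_mjp phi_init).
- exact: (expected_occupation_time n0 p_tf p_gen p_tr phi_mjp phi_init).
- exact: (expected_occupation_time_product n0 p_tf p_gen p_tr phi_mjp phi_init).
Qed.
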